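(* Let $t\ge1$ and let $G$ be a group of order $4t+2$. The following are equivalent. I. $Z^2(G,\langle-1\rangle)$ contains a quasi-orthogonal cocycle. II. There is a quasi-Hadamard group $E$, with central subgroup $\langle-1\rangle$ of order $2$ such that $E/\langle-1\rangle\cong G$, containing a relative $(4t+2,2,4t+2,2t+1)$-quasi-difference set with forbidden subgroup $\langle-1\rangle$. III. There exist a $(\pm1)$-matrix $M$ as below and a $\mathrm{PBIBD}(4)$, with incidence matrix $\Phi$, on the association scheme $A_0,\dots,A_4$ built from $M$, with parameters $v=b=8t+4$, $r=k=4t+2$, $\lambda_1=0,\lambda_2=2t+1,\lambda_3=2t+2,\lambda_4=2t$, on which a quasi-Hadamard group $E$ with central subgroup $\langle-1\rangle$ of order 2 and $E/\langle-1\rangle\cong G$ acts regularly (on points and on blocks, preserving incidence), and which is $R_1$-class regular with respect to $\langle-1\rangle$ (i.e. $\langle-1\rangle$ acts regularly on each point class $\{i,i+4t+2\}$).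
   Context: Cocycles: maps $\psi:G\times G\to\{\pm1\}$ with $\psi(g,h)\psi(gh,k)=\psi(g,hk)\psi(h,k)$ and $\psi(1,1)=1$; $Z^2(G,\langle-1\rangle)$ is their set. For an ordering $g_1=1,\dots,g_{4t+2}$ of $G$, $M_\psi=[\psi(g_i,g_j)]$; for an $n\times n$ $(\pm1)$-matrix with first row all $1$s, $RE(M)=\sum_{i=2}^n|\sum_jm_{i,j}|$; $\psi$ is quasi-orthogonal if $RE(M_\psi)=4t$. A group $E$ of order $8t+4\ge12$ with central subgroup $Z$ of order $2$ is a quasi-Hadamard group if it has a transversal $T$ for $Z$ containing $S\subset T\setminus Z$, $|S|=2t+1$, with $|T\cap xT|=2t+1$ for $x\in S$ and $|T\cap xT|\in\{2t,2t+2\}$ for $x\in T\setminus(S\cup Z)$. A relative $(4t+2,2,4t+2,2t+1)$-quasi-difference set in $E$ (order $8t+4$) with forbidden normal subgroup $Z$ of order 2 is a transversal $R$ for $Z$ containing $S\subset R\setminus\{1\}$, $|S|=2t+1$, such that for all $x\in E\setminus Z$: $|R\cap xR|=2t+1$ if $x\in sZ$ for some $s\in S$, and $|R\cap xR|\in\{2t,2t+2\}$ otherwise. In III, $M$ is a $(4t+2)\times(4t+2)$ $(\pm1)$-matrix with $\mathrm{abs}(MM^\top)=\begin{bmatrix}4tI_{2t+1}+2J_{2t+1}&0\\0&4tI_{2t+1}+2J_{2t+1}\end{bmatrix}$ ($I,J$ identity and all-ones, $\mathrm{abs}$ entrywise absolute value, $\otimes$ Kronecker product); with $K=I_2\otimes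 J_{2t+1}$, $\Delta_1=\tfrac14(MM^\top+2K-(4t+4)I)$, $\Delta_2=\tfrac14(2K+4tI-MM^\top)$: $A_0=I_{8t+4}$, $A_1=(J_2-I_2)\otimes I_{4t+2}$, $A_2=J_2\otimes(J_2-I_2)\otimes J_{2t+1}$, $A_3=I_2\otimes\Delta_1+(J_2-I_2)\otimes\Delta_2$, $A_4=I_2\otimes\Delta_2+(J_2-I_2)\otimes\Delta_1$ on points $\{1,\dots,8t+4\}$, with $R_i=\{(x,y):(A_i)_{xy}=1\}$. A $\mathrm{PBIBD}(4)$ with parameters $v,b,r,k,\lambda_1,\dots,\lambda_4$ on this scheme: $b$ blocks of size $k$, each point in $r$ blocks, points $x,y$ with $(x,y)\in R_i$ ($i\ge1$) together in exactly $\lambda_i$ blocks. *)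

(* Defs.v *)
From HB Require Import structures.
From mathcomp Require Import all_boot all_order all_algebra all_fingroup all_solvable.
From mathcomp.real_closed Require Import mxtens.

Set Implicit Arguments.
Unset Strict Implicit.
Unset Printing Implicit Defensive.

Import GRing.Theory Num.Theory.

Local Open Scope ring_scope.

(** * Cocycles and quasi-orthogonality *)

Definition pm1 (a : rat) : Prop := a = 1 \/ a = -1.

Definition cocycle (gT : finGroupType) (psi : gT -> gT -> rat) : Prop :=
  [/\ forall g h, pm1 (psi g h),
      forall g h k, psi g h * psi (g * h)%g k = psi g (h * k)%g * psi h k
    & psi 1%g 1%g = 1].

(* Indices start at 0, so the condition g_1 = 1 reads g 0 = 1. *)
Definition ordering (gT : finGroupType) (n : nat) (g : 'I_n -> gT) : Prop :=
  bijective g /\ forall i : 'I_n, i = 0%N :> nat -> g i = 1%g.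

Definition cocyclic_mx (gT : finGroupType) (n : nat) (g : 'I_n -> gT)
    (psi : gT -> gT -> rat) : 'M[rat]_n :=
  \matrix_(i, j) psi (g i) (g j).

Definition row_excess (n : nat) (M : 'M[rat]_n) : rat :=
  \sum_(i < n | (0 < i)%N) `|\sum_(j < n) M i j|.

(* The row excess of cocyclic_mx g psi does not depend on the ordering g, so
   asking for one ordering is the same as asking for all of them. *)
Definition quasi_orthogonal (gT : finGroupType) (t : nat)
    (psi : gT -> gT -> rat) : Prop :=
  exists2 g : 'I_(4 * t + 2) -> gT,
    ordering g & row_excess (cocyclic_mx g psi) = (4 * t)%:R.

(** * Quasi-Hadamard groups and relative quasi-difference sets *)

Local Open Scope group_scope.

Definition group_transversal (eT : finGroupType) (Z : {group eT})
    (T : {set eT}) : Prop :=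
  is_transversal T (lcosets Z [set: eT]) [set: eT].

Definition central_order2 (eT : finGroupType) (Z : {group eT}) : Prop :=
  Z \subset 'Z([set: eT]) /\ #|Z| = 2%N.

Definition quasi_Hadamard_group (eT : finGroupType) (t : nat)
    (Z : {group eT}) : Prop :=
  [/\ (12 <= 8 * t + 4)%N,
      #|eT| = (8 * t + 4)%N,
      central_order2 Z
    & exists T S : {set eT},
        [/\ group_transversal Z T,
            S \subset T :\: Z,
            #|S| = (2 * t + 1)%N,
            forall x, x \in S -> #|T :&: (x *: T)| = (2 * t + 1)%N
          & forall x, x \in T :\: (S :|: Z) ->
              #|T :&: (x *: T)| = (2 * t)%N
              \/ #|T :&: (x *: T)| = (2 * t + 2)%N]].

(* The parameters are (4t+2, 2, 4t+2, 2t+1), and Z is the forbidden subgroup. *)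
Definition relative_quasi_difference_set (eT : finGroupType) (t : nat)
    (Z : {group eT}) (R : {set eT}) : Prop :=
  [/\ #|eT| = (8 * t + 4)%N,
      Z <| [set: eT] /\ #|Z| = 2%N,
      group_transversal Z R
    & exists S : {set eT},
        [/\ S \subset R :\ 1,
            #|S| = (2 * t + 1)%N
          & forall x, x \notin Z ->
              if [exists s in S, x \in s *: Z]
              then #|R :&: (x *: R)| = (2 * t + 1)%N
              else #|R :&: (x *: R)| = (2 * t)%N
                   \/ #|R :&: (x *: R)| = (2 * t + 2)%N]].

Definition regular_on (aT : finGroupType) (A : {group aT}) (rT : finType)
    (to : {action aT &-> rT}) (D : {set rT}) : Prop :=
  [transitive A, on D | to] /\ {in D, forall x, 'C_A[x | to] = 1}.

Local Close Scope group_scope.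

(** * The relations A_0, ..., A_4 *)

(* Matrices of order 4t+2 and 8t+4 are given the sizes 2 * (2 * t + 1) and
   2 * (2 * (2 * t + 1)), so that Kronecker products typecheck without casts.
   The entry of A *t B at (i * n + k, j * n + l) is A i j * B k l, where n is
   the order of B. *)

Definition allones (n : nat) : 'M[rat]_n := const_mx 1.

(* A block-diagonal matrix with two equal blocks B is 1%:M *t B. *)
Definition gram_condition (t : nat) (M : 'M[rat]_(2 * (2 * t + 1))) : Prop :=
  map_mx Num.norm (M *m M^T) =
  (1%:M : 'M[rat]_2) *t ((4 * t)%:R%:M + 2 *: allones (2 * t + 1)).

Definition admissible_mx (t : nat) (M : 'M[rat]_(2 * (2 * t + 1))) : Prop :=
  (forall i j, pm1 (M i j)) /\ gram_condition M.

Definition Delta1 (t : nat) (M : 'M[rat]_(2 * (2 * t + 1))) :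
    'M[rat]_(2 * (2 * t + 1)) :=
  let K := (1%:M : 'M[rat]_2) *t allones (2 * t + 1) in
  4^-1 *: (M *m M^T + 2 *: K - (4 * t + 4)%:R%:M).

Definition Delta2 (t : nat) (M : 'M[rat]_(2 * (2 * t + 1))) :
    'M[rat]_(2 * (2 * t + 1)) :=
  let K := (1%:M : 'M[rat]_2) *t allones (2 * t + 1) in
  4^-1 *: (2 *: K + (4 * t)%:R%:M - M *m M^T).

Definition scheme_mx (t : nat) (M : 'M[rat]_(2 * (2 * t + 1))) :
    5.-tuple 'M[rat]_(2 * (2 * (2 * t + 1))) :=
  let I2 : 'M[rat]_2 := 1%:M in
  let J2 := allones 2 in
  [tuple 1%:M;
         (J2 - I2) *t 1%:M;
         J2 *t ((J2 - I2) *t allones (2 * t + 1));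
         I2 *t Delta1 M + (J2 - I2) *t Delta2 M;
         I2 *t Delta2 M + (J2 - I2) *t Delta1 M].

Definition scheme_rel (t : nat) (M : 'M[rat]_(2 * (2 * t + 1))) (i : 'I_5) :
    rel 'I_(2 * (2 * (2 * t + 1))) :=
  fun x y => tnth (scheme_mx M) i x y == 1.

(** * Designs *)

(* Rows of Phi are points and columns are blocks (possibly repeated);
   tnth lambda i is the parameter attached to the relation R_(i+1). *)
Definition PBIBD4 (v b r k : nat) (lambda : 4.-tuple nat)
    (R : 'I_5 -> rel 'I_v) (Phi : 'M[rat]_(v, b)) : Prop :=
  [/\ forall x B, Phi x B = 0 \/ Phi x B = 1,
      forall B, #|[set x | Phi x B == 1]| = k,
      forall x, #|[set B | Phi x B == 1]| = r
    & forall (i : 'I_4) x y, R (lift ord0 i) x y ->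
        #|[set B | (Phi x B == 1) && (Phi y B == 1)]| = tnth lambda i].

Definition point_class (t : nat) (i : 'I_(2 * (2 * t + 1))) :
    {set 'I_(2 * (2 * (2 * t + 1)))} :=
  [set p : 'I_(2 * (2 * (2 * t + 1))) |
     (p == i :> nat) || (p == i + 2 * (2 * t + 1) :> nat)%N].

(* MathComp actions are right actions; x |-> x acted on by e^-1 turns them
   into left actions with the same orbits and stabilisers. *)
Definition regular_design_action (eT : finGroupType) (v b : nat)
    (Phi : 'M[rat]_(v, b)) (toP : {action eT &-> 'I_v})
    (toB : {action eT &-> 'I_b}) : Prop :=
  [/\ forall e x B, Phi (toP x e) (toB B e) = Phi x B,
      regular_on [set: eT]%G toP [set: 'I_v]
    & regular_on [set: eT]%G toB [set: 'I_b]].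

Definition R1_class_regular (eT : finGroupType) (t : nat) (Z : {group eT})
    (toP : {action eT &-> 'I_(2 * (2 * (2 * t + 1)))}) : Prop :=
  forall i : 'I_(2 * (2 * t + 1)), regular_on Z toP (point_class i).

(* Main.v *)
Require Import Defs.
From HB Require Import structures.
From mathcomp Require Import all_boot all_order all_algebra all_fingroup all_solvable.
From mathcomp.real_closed Require Import mxtens.
From mathcomp Require Import zify lra.

(* Write a cocycle as psi = (-1)^b with b valued in bool, n = 4t+2 = #|G|, and
   let p(g) be the number of h with psi(g,h) = 1.  Row g of M_psi has sum
   2 p(g) - n.  Summing the cocycle identity over the last variable and using
   that n is even, the parity of p is a homomorphism G -> Z/2; on its kernel H
   the row sums are at least 2 in absolute value.  Hence a row excess of 4t is
   only possible if H has index 2, and then all row sums vanish off H and are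
   2 or -2 on H minus the identity.

   In the central extension E_psi = {1,-1} x G the transversal T = {1} x G
   satisfies |T :&: (a,g)T| = #{h | psi(g,h) = a}, so it is a quasi-Hadamard
   transversal; conversely the cocycle of a quasi-Hadamard transversal has row
   sums 0 on S and 2 or -2 elsewhere off the identity.  The same T is a
   quasi-difference set, since |T :&: xT| + |T :&: xzT| = |T| for the central
   involution z.  The design has the elements of E_psi both as points and as
   blocks, x being incident with y when xy lies in T; two points over g and h
   share #{k | psi(g,k) psi(h,k) = c} blocks for a sign c, and the cocycle
   identity turns this into a row count of g h^-1.  Listing G with the cosets
   of H contiguous gives M the required block form. *)

Set Implicit Arguments.
Unset Strict Implicit.
Unset Printing Implicit Defensive.

(** * Transversals of a central subgroup of order two *)

Section Transversals.
Local Open Scope group_scope.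
Variables (eT : finGroupType) (Z : {group eT}).
Implicit Types (x y z : eT) (T : {set eT}).

Lemma central_order2P : central_order2 Z ->
  exists z, [/\ z != 1, Z =i [set 1; z], z * z = 1
              & forall x, commute x z].
Proof.
case=> cZ cardZ; have /cards2P[x [y [xy defZ]]] : #|Z| == 2 by apply/eqP.
have memZ w : (w \in Z) = (w \in [set x; y]) by rewrite -defZ.
have [z z1 defZ'] : exists2 z, z != 1 & Z =i [set 1; z].
  have := group1 Z; rewrite memZ !inE => /orP[] /eqP e; move: xy; rewrite -e.
    by rewrite eq_sym; exists y => // w; rewrite e -memZ.
  by exists x => // w; rewrite e setUC -memZ.
have Zz : z \in Z by rewrite defZ' !inE eqxx orbT.
exists z; split=> //.
  have := groupM Zz Zz; rewrite defZ' !inE => /orP[] /eqP // /eqP.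
  by rewrite -{3}[z]mulg1 (inj_eq (mulgI _)) (negPf z1).
move=> w; have /centerP[_ cz] := subsetP cZ _ Zz.
exact/commute_sym/cz/in_setT.
Qed.

Variable z : eT.
Hypotheses (z1 : z != 1) (defZ : Z =i [set 1; z]).
Hypotheses (zz : z * z = 1) (cz : forall x, commute x z).

Let lcosetZ y : y *: Z = [set y; y * z].
Proof.
apply/setP=> w; rewrite mem_lcoset defZ !inE.
by rewrite -(inj_eq (mulgI y) _ 1) -(inj_eq (mulgI y) _ z) mulKVg mulg1.
Qed.

(** Each coset of [Z] is a pair [y], [y * z], so meeting it exactly once means containing exactly
    one of the two. *)
Lemma transversal_order2P T :
  group_transversal Z T <-> forall y, (y * z \in T) = (y \notin T).
Proof.
have card2 y : #|T :&: y *: Z| = (y \in T) + (y * z \in T).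
  have yz : y * z != y by rewrite -{2}[y]mulg1 (inj_eq (mulgI y)).
  rewrite lcosetZ (cardsD1 y) (cardsD1 (y * z)) !inE !eqxx yz ?orbT !andbT /=.
  rewrite addnA -[RHS]addn0; congr (_ + _); apply: eq_card0 => w.
  by rewrite !inE; case: (w == y); case: (w == _); rewrite ?andbF.
have part : partition (lcosets Z [set: eT]) [set: eT].
  (* Left and right cosets coincide because [z] is central, so the partition into right cosets can
     be used. *)
  suff -> : lcosets Z [set: eT] = rcosets Z [set: eT].
    by apply: rcosets_partition; apply: subsetT.
  apply: eq_imset => x; rewrite lcosetE rcosetE; apply/setP => y.
  rewrite lcosetZ !inE mem_rcoset defZ !inE.
  by rewrite -(inj_eq (mulIg x) _ 1) -(inj_eq (mulIg x) _ z) mulgKV mul1g (cz x).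
rewrite /group_transversal /is_transversal part subsetT /=; split.
  move=> /forall_inP trT y; have /trT : y *: Z \in lcosets Z [set: eT].
    by apply/lcosetsP; exists y; rewrite ?in_setT.
  by rewrite card2; case: (y \in T); case: (y * z \in T).
move=> trT; apply/forall_inP => _ /lcosetsP[y _ ->].
by rewrite card2 trT; case: (y \in T).
Qed.

(** Multiplication by [z] exchanges [T] with its complement. *)
Lemma card_transversal_order2 T : group_transversal Z T -> #|eT| = (2 * #|T|)%N.
Proof.
move=> /transversal_order2P trT; rewrite -(cardsC T) mul2n -addnn.
congr (_ + _)%N; rewrite -(card_imset T (mulIg z)); apply: eq_card => y.
rewrite !inE -trT; apply/idP/imsetP => [yT | [x xT ->]]; last by rewrite -mulgA zz mulg1.
by exists (y * z); rewrite // -mulgA zz mulg1.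
Qed.

Lemma card_translateI T x :
  #|T :&: x *: T| = #|[set y in T | x * y \in T]|.
Proof.
rewrite -[RHS](card_lcoset _ x); apply: eq_card => y.
by rewrite mem_lcoset !inE mem_lcoset mulKVg andbC.
Qed.

(** For [y] in [T], exactly one of [x * y] and [x * z * y] lies in [T], so the two counts split
    [T]. *)
Lemma card_translateI_mulz T x : group_transversal Z T ->
  (#|T :&: x *: T| + #|T :&: (x * z) *: T| = #|T|)%N.
Proof.
move=> /transversal_order2P trT; rewrite !card_translateI.
rewrite -(cardsID [set y | x * y \in T] T); congr (_ + _)%N; apply: eq_card => y.
  by rewrite !inE.
by rewrite !inE -mulgA -(cz y) mulgA trT andbC.
Qed.

End Transversals.

(** [T] and [S] serve unchanged. Each coset of [Z] other than [Z] has one representative in [T], to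
    which the hypotheses apply. For the other representative the intersection number [k] becomes
    [4t + 2 - k], which fixes [2t + 1] and swaps [2t] with [2t + 2]. *)
Lemma quasi_Hadamard_relative_quasi_difference_set (eT : finGroupType) t
    (Z : {group eT}) :
  quasi_Hadamard_group t Z -> exists R, relative_quasi_difference_set t Z R.
Proof.
case=> _ cardE cZ [T [S [trT ST cardS onS offS]]].
have [z [z1 defZ zz cz]] := central_order2P cZ.
have cardT : #|T| = (4 * t + 2)%N.
  by have := card_transversal_order2 z1 defZ zz cz trT; lia.
have addI x := card_translateI_mulz z1 defZ cz x trT.
have /(transversal_order2P z1 defZ cz) Tz := trT.
exists T; split=> //; first by split; [apply: sub_center_normal; case: cZ | case: cZ].
have S1 x : x \in S -> (x \in T) && (x \notin Z) by move/(subsetP ST); rewrite inE andbC.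
exists S; split=> //.
  apply/subsetP => x /S1/andP[xT xZ]; rewrite !inE xT andbT.
  by apply: contraNneq xZ => ->; apply: group1.
have cosetZ x s : (x \in s *: Z)%g = (x == s) || (x == s * z)%g.
  rewrite mem_lcoset defZ !inE -(inj_eq (mulgI s) _ 1%g).
  by rewrite -(inj_eq (mulgI s) _ z) mulKVg mulg1.
have main x : x \notin Z -> x \in T ->
    if x \in S then #|T :&: (x *: T)%g| = (2 * t + 1)%N
    else #|T :&: (x *: T)%g| = (2 * t)%N \/ #|T :&: (x *: T)%g| = (2 * t + 2)%N.
  move=> xZ xT; case: ifP => xS; first exact: onS.
  by apply: offS; rewrite !inE xS xT (negPf xZ).
move=> x xZ; case xT : (x \in T).
  suff -> : [exists s in S, x \in s *: Z]%g = (x \in S) by exact: main.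
  apply/exists_inP/idP => [[s sS] | xS]; last by exists x; rewrite // cosetZ eqxx.
  rewrite cosetZ => /orP[/eqP-> // | /eqP xs].
  by move: xT; rewrite xs Tz; case/S1/andP: sS => ->.
have xzT : (x * z)%g \in T by rewrite Tz xT.
have zZ : z \in Z by rewrite defZ !inE eqxx orbT.
have := main (x * z)%g; rewrite groupMr // => /(_ xZ xzT).
have -> : [exists s in S, x \in s *: Z]%g = ((x * z)%g \in S).
  apply/exists_inP/idP => [[s sS] | xS].
    2: by exists (x * z)%g; rewrite // cosetZ -mulgA zz mulg1 eqxx orbT.
  rewrite cosetZ => /orP[/eqP xs | /eqP ->]; last by rewrite -mulgA zz mulg1.
  by move: xT; rewrite xs; case/S1/andP: sS => ->.
by have := addI x; rewrite cardT; case: ifP => _; move: #|_| #|_| => k l; lia.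
Qed.

(** * Boolean cocycles, parity of row counts and minimal excess *)

Lemma odd_card_addb (I : finType) (P Q : pred I) :
  odd #|[set i | P i (+) Q i]| = odd #|[set i | P i]| (+) odd #|[set i | Q i]|.
Proof.
have oddE (R : pred I) : odd #|[set i | R i]| = \big[addb/false]_i R i.
  rewrite -sum1_card big_mkcond (big_morph odd oddD erefl) /=.
  by apply: eq_bigr => i _; rewrite inE; case: (R i).
by rewrite !oddE big_split.
Qed.

Section SignCocycles.
Variables (gT : finGroupType).
Implicit Types (b : gT -> gT -> bool) (g h k : gT).

Definition sign_cocycle b : Prop :=
  (forall g h k, b g h (+) b (g * h)%g k = b g (h * k)%g (+) b h k)
  /\ b 1%g 1%g = false.

Definition plus_card b g := #|[set h | ~~ b g h]|.

(** The two truncated subtractions add up to the distance from [plus_card b g] to [m]. For a group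
    of order [2m] the sum is therefore half the row excess. *)
Definition excess (m : nat) b : nat :=
  \sum_(g | g != 1%g) ((plus_card b g - m) + (m - plus_card b g)).

Lemma odd_plus_cardM b g h : ~~ odd #|gT| -> sign_cocycle b ->
  odd (plus_card b (g * h)%g) = odd (plus_card b g) (+) odd (plus_card b h).
Proof.
move=> evenG [coc _].
have oddc (c : bool) : odd #|[set _ : gT | c]| = false.
  by case: c; rewrite ?cards0 // cardsT (negPf evenG).
have -> : plus_card b g = #|[set k | ~~ b g (h * k)%g]|.
  rewrite /plus_card -[LHS](card_preimset _ (mulgI h)).
  by apply: eq_card => k; rewrite !inE.
(* The term [b g h] does not depend on [k]: it contributes the whole group or nothing, and both have
   even size. *)
rewrite -[RHS]addbF -(oddc (~~ b g h)) -!odd_card_addb; congr odd.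
apply: eq_card => k; rewrite !inE; have := coc g h k.
by case: (b (g * h)%g k); case: (b g (h * k)%g); case: (b g h); case: (b h k).
Qed.

(** Compare the terms of [excess] with the indicator of the kernel [H] of the parity map. On [H] the
    count is even while [2t + 1] is odd, so each term there is at least 1. The given excess leaves
    no slack once [H] has index 2. *)
Lemma excess_min t b : #|gT| = (4 * t + 2)%N -> sign_cocycle b ->
    excess (2 * t + 1) b = (2 * t)%N ->
  exists H : {group gT}, [/\ #|H| = (2 * t + 1)%N,
    forall g, g \notin H -> plus_card b g = (2 * t + 1)%N
  & forall g, g \in H -> g != 1%g ->
      plus_card b g = (2 * t)%N \/ plus_card b g = (2 * t + 2)%N].
Proof.
move=> cardG cocb excb.
have evenG : ~~ odd #|gT| by rewrite cardG; lia.
pose p g := odd (plus_card b g); have pM g h := odd_plus_cardM g h evenG cocb.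
have gH : group_set [set g | ~~ p g].
  apply/group_setP; split; last by move=> g h; rewrite !inE /p pM => /negPf-> /negPf->.
  by rewrite inE; have := pM 1%g 1%g; rewrite mulg1 addbb /p => ->.
pose H := Group gH; exists H.
have memH g : (g \in H) = ~~ p g by rewrite inE.
pose F g := ((plus_card b g - (2 * t + 1)) + (2 * t + 1 - plus_card b g))%N.
have leF g : g != 1%g -> (g \in H <= F g ?= iff (F g == (g \in H)))%N.
  move=> _; split; last by rewrite eq_sym.
  rewrite memH /F /p; have [//|] := boolP (odd _); lia.
have sumH : (\sum_(g | g != 1%g) (g \in H) = #|H|.-1)%N.
  rewrite (cardsD1 1%g H) group1 /= -sum1_card [LHS]big_mkcond [RHS]big_mkcond /=.
  by apply: eq_bigr => g _; rewrite !inE; case: (g == 1%g) => //=; case: (_ \in H).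
(* [leH] becomes the bound [#|H| - 1 <= 2t], and [eqH] says that it is attained only if every term
   attains its own bound. *)
have [leH eqH] := leqif_sum leF.
rewrite -/(excess (2 * t + 1) b) excb sumH in leH eqH.
have cardH : #|H| = (2 * t + 1)%N.
  (* Either [H] misses some [x] and its complement is the coset of [x], or [H] is the whole group
     and [leH] would give [4t + 1 <= 2t]. *)
  have [x xH | HT] := pickP [pred x | x \notin H].
    suff : (#|H| + #|H| = #|gT|)%N by rewrite cardG; lia.
    rewrite -(cardsC H) -{2}(card_lcoset H x); congr (_ + _)%N.
    apply: eq_card => y; rewrite mem_lcoset inE.
    have := pM x (x^-1 * y)%g; rewrite mulKVg => e; move: xH; rewrite /= !memH.
    by rewrite !inE /p e; do 2!case: (odd _).
  have : #|H| = #|gT|.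
    by rewrite -cardsT; apply: eq_card => y; rewrite [RHS]inE; exact: negbFE (HT y).
  rewrite cardG; lia.
move: eqH; rewrite cardH addn1 eqxx => /esym/forall_inP eqF.
have valF g : g != 1%g -> F g = (g \in H) by move=> /eqF/eqP.
split=> // g gH'.
  have g1 : g != 1%g by apply: contraNneq gH' => ->; apply: group1.
  by have := valF g g1; rewrite (negPf gH') /F; lia.
by move=> g1; have := valF g g1; rewrite gH' /F; lia.
Qed.

End SignCocycles.

(** * Passage between rational and boolean cocycles *)

Section RationalCocycles.
Import GRing.Theory Num.Theory.
Local Open Scope ring_scope.
Variables (gT : finGroupType) (m : nat).
Hypothesis cardG : #|gT| = (2 * m)%N.
Implicit Types (b : gT -> gT -> bool) (g h k : gT).

Definition sign_of b g h : rat := (-1) ^+ b g h.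

Lemma sum_sign (I : finType) (P : pred I) :
  \sum_i (-1) ^+ P i = (2 * #|[set i | ~~ P i]|)%:R - #|I|%:R :> rat.
Proof.
rewrite natrM -!sum1_card !natr_sum mulr_sumr [X in _ = X - _]big_mkcond /= -sumrB.
by apply: eq_bigr => i _; rewrite inE; case: (P i); rewrite /=; lra.
Qed.

(** The row sum at [g] is [2 * plus_card b g - 2 * m]. Since [ordering] puts the identity at index
    0, both sums omit the same row. *)
Lemma row_excess_sign (n : nat) (e : 'I_n -> gT) b :
    ordering e ->
  row_excess (cocyclic_mx e (sign_of b)) = (2 * excess m b)%:R.
Proof.
move=> [bij_e e0]; rewrite /row_excess /excess natrM natr_sum mulr_sumr.
rewrite [RHS](reindex e) /=; last exact: onW_bij.
have n0 : (0 < n)%N by case: bij_e => f _ _; apply: leq_ltn_trans (ltn_ord (f 1%g)).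
apply: eq_big => [i | i _].
  rewrite lt0n; congr (~~ _); apply/eqP/eqP => [/e0 // | ei].
  by rewrite -(e0 (Ordinal n0)) // in ei; move/(bij_inj bij_e): ei => ->.
transitivity `|\sum_h sign_of b (e i) h|.
  rewrite [in RHS](reindex e) /=; last exact: onW_bij.
  by congr `|_|; apply: eq_bigr => j _; rewrite mxE.
rewrite /sign_of sum_sign cardG -/(plus_card b (e i)); set p := plus_card _ _.
case: (leqP p m) => pm.
  rewrite (_ : (p - m)%N = 0%N) ?add0n ?natrB //; last lia.
  rewrite ler0_norm ?subr_le0 ?ler_nat ?leq_mul2l // !natrM; lra.
rewrite (_ : (m - p)%N = 0%N) ?addn0 ?natrB 1?ltnW //; last lia.
rewrite ger0_norm ?subr_ge0 ?ler_nat ?leq_mul2l ?(ltnW pm) // !natrM; lra.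
Qed.

Lemma cocycle_signP b : cocycle (sign_of b) <-> sign_cocycle b.
Proof.
rewrite /cocycle /sign_cocycle /sign_of; split=> [[_ coc coc1] | [coc coc1]].
  split=> [g h k|]; last by case: (b _ _) coc1.
  by have := coc g h k; rewrite -!signr_addb => /eqP; do 2!case: (_ (+) _).
split=> [g h | g h k | ]; last by rewrite coc1.
  by case: (b g h); [right | left].
by rewrite -!signr_addb coc.
Qed.

Lemma exists_ordering (n : nat) : #|gT| = n -> exists e : 'I_n -> gT, ordering e.
Proof.
move=> cardn; have n0 : (0 < n)%N by rewrite -cardn; apply/card_gt0P; exists 1%g.
pose i0 := Ordinal n0.
pose f (i : 'I_n) : gT := enum_val (cast_ord (esym cardn) i).
have bij_f : bijective f.
  apply: bij_comp (@enum_val_bij gT) _.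
  exact: (Bijective (cast_ordK _) (cast_ordKV _)).
(* Any enumeration becomes an ordering after swapping its first value with the identity. *)
pose s := tperm (f i0) 1%g.
exists (s \o f); split; first exact: bij_comp (Bijective (permK s) (permKV s)) bij_f.
by move=> i i_0; rewrite (_ : i = i0) /= ?tpermL //; apply: val_inj.
Qed.

End RationalCocycles.

(** The row excess [4t] corresponds to [excess] equal to [2t], and every cocycle [psi] is the sign
    of the boolean function [psi g h == -1]. *)
Lemma quasi_orthogonalP (gT : finGroupType) t : #|gT| = (4 * t + 2)%N ->
  (exists psi : gT -> gT -> rat, cocycle psi /\ quasi_orthogonal t psi) <->
  (exists b, sign_cocycle b /\ @excess gT (2 * t + 1) b = (2 * t)%N).
Proof.
move=> cardG; have cardG2 : #|gT| = (2 * (2 * t + 1))%N by rewrite cardG; lia.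
have exc_eq (b : gT -> gT -> bool) (e : 'I_(4 * t + 2) -> gT) : ordering e ->
    row_excess (cocyclic_mx e (sign_of b)) = (4 * t)%:R%R <->
    excess (2 * t + 1) b = (2 * t)%N.
  move=> ord_e; rewrite (row_excess_sign cardG2) //.
  by split=> [/eqP | ->]; [rewrite Num.Theory.eqr_nat; lia | congr (_%:R)%R; lia].
split=> [[psi [coc [e ord_e exc]]] | [b [coc exc]]].
  have sgn g h : psi g h = sign_of (fun g h => psi g h == -1)%R g h.
    by rewrite /sign_of; case: coc => /(_ g h)[] -> _ _.
  exists (fun g h => psi g h == -1)%R; split.
    apply/cocycle_signP; case: coc => c1 c2 c3.
    by split=> *; rewrite -!sgn.
  apply/(exc_eq _ _ ord_e); rewrite -exc; congr row_excess.
  by apply/matrixP => i j; rewrite !mxE -sgn.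
have [e ord_e] := exists_ordering cardG.
by exists (sign_of b); split; [apply/cocycle_signP | exists e => //; apply/exc_eq].
Qed.

(** * The central extension defined by a cocycle, with its transversal *)

Section Extension.
Local Open Scope group_scope.
Variables (gT : finGroupType) (b : gT -> gT -> bool).

Lemma sign_cocycle1g : sign_cocycle b -> forall k, b 1 k = false.
Proof. by case=> coc b1 k; have := coc 1 1 k; rewrite !mul1g b1 addbb. Qed.

Lemma sign_cocycleg1 : sign_cocycle b -> forall g, b g 1 = false.
Proof. by case=> coc b1 g; have := coc g 1 1; rewrite !mulg1 b1 addbb addbF. Qed.

(* The pair (a, g) stands for the element (-1)^a g. *)
Definition cocycle_ext of sign_cocycle b : Type := (bool * gT)%type.

Variable cocb : sign_cocycle b.
Local Notation E := (cocycle_ext cocb).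

HB.instance Definition _ := Finite.copy E (bool * gT)%type.

Definition ext_mul (x y : E) : E := (x.1 (+) y.1 (+) b x.2 y.2, x.2 * y.2).
Definition ext_one : E := (false, 1).
Definition ext_inv (x : E) : E := (x.1 (+) b x.2^-1 x.2, x.2^-1).

Lemma ext_mulA : associative ext_mul.
Proof.
move=> [a g] [a' h] [a'' k]; rewrite /ext_mul /= mulgA; congr pair.
have := proj1 cocb g h k.
by case: (b g h); case: (b (g * h) k); case: (b g (h * k)); case: (b h k) => //;
   case: a; case: a'; case: a''.
Qed.

Lemma ext_mul1g : left_id ext_one ext_mul.
Proof. by move=> [a g]; rewrite /ext_mul /= sign_cocycle1g // addbF mul1g. Qed.

Lemma ext_mulVg : left_inverse ext_one ext_inv ext_mul.
Proof. by move=> [a g]; rewrite /ext_mul /= mulVg; case: a; case: (b _ _). Qed.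

HB.instance Definition _ := Finite_isGroup.Build E ext_mulA ext_mul1g ext_mulVg.

Lemma ext_mulE (x y : E) : x * y = (x.1 (+) y.1 (+) b x.2 y.2, x.2 * y.2) :> E.
Proof. by []. Qed.

Definition ext_proj (x : E) : gT := x.2.

Lemma ext_projM : {in [set: E] &, {morph ext_proj : x y / x * y}}.
Proof. by []. Qed.

Canonical ext_proj_morphism := Morphism ext_projM.

Definition ext_center : {group E} := 'ker ext_proj_morphism.

Lemma mem_ext_center (x : E) : (x \in ext_center) = (x.2 == 1).
Proof. by rewrite !inE. Qed.

Lemma ext_center_order2 : central_order2 ext_center.
Proof.
split.
  apply/subsetP => x; rewrite mem_ext_center => /eqP x1.
  apply/centerP; split=> [|y _]; first exact: in_setT.
  rewrite /commute !ext_mulE x1 mul1g mulg1 sign_cocycle1g // sign_cocycleg1 //.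
  by rewrite (addbC x.1).
have -> : #|ext_center| = #|(fun a => (a, 1) : E) @: [set: bool]|.
  apply: eq_card => x; rewrite mem_ext_center.
  apply/eqP/imsetP => [x1 | [a _ ->] //]; exists x.1; rewrite ?in_setT //.
  by rewrite -x1 -surjective_pairing.
by rewrite card_imset ?cardsT ?card_bool // => a a' [].
Qed.

Lemma ext_quotient_isog : [set: E] / ext_center \isog [set: gT].
Proof.
have <- : ext_proj_morphism @* [set: E] = [set: gT].
  apply/setP => g; rewrite inE; apply/morphimP.
  by exists (false, g) => //; rewrite in_setT.
exact: first_isog.
Qed.

Definition ext_transversal : {set E} := [set x | ~~ x.1].

Lemma ext_transversalP : group_transversal ext_center ext_transversal.
Proof.
have [z [z1 defZ zz cz]] := central_order2P ext_center_order2.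
apply/(transversal_order2P z1 defZ cz) => x.
have z2 : z.2 = 1 by apply/eqP; rewrite -mem_ext_center defZ !inE eqxx orbT.
have {z1} z1 : z.1.
  by move: z z1 z2 {zz cz defZ} => [[] g] //= ne g1; rewrite g1 in ne; case/eqP: ne.
by rewrite !inE ext_mulE z1 z2 /= sign_cocycleg1 // addbF addbT.
Qed.

(** The product of [x] with [(false, h)] has sign bit [x.1 (+) b x.2 h], so it lies in the
    transversal exactly when [b x.2 h = x.1]. *)
Lemma card_ext_translateI (x : E) :
  #|ext_transversal :&: x *: ext_transversal| = #|[set h | b x.2 h == x.1]|.
Proof.
rewrite card_translateI.
rewrite -(card_imset [set h | _] (f := fun h => (false, h) : E)); last by move=> g h [].
apply: eq_card => y; rewrite !inE ext_mulE /=; apply/andP/imsetP.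
  case: y => [a h] /= [/negPf -> e]; exists h => //.
  by rewrite inE; move: e; case: (x.1); case: (b _ _).
by case=> h; rewrite inE => /eqP <- -> /=; case: (b _ _).
Qed.

End Extension.

(** The set [S] is the part of the transversal lying over the complement of the index 2 subgroup [H]
    given by [excess_min]. *)
Lemma excess_quasi_Hadamard (gT : finGroupType) t b (cocb : @sign_cocycle gT b) :
    (1 <= t)%N -> #|gT| = (4 * t + 2)%N -> excess (2 * t + 1) b = (2 * t)%N ->
  quasi_Hadamard_group t (ext_center cocb).
Proof.
move=> t1 cardG exc; have [H [cardH offH onH]] := excess_min cardG cocb exc.
split; [lia | | exact: ext_center_order2 | ].
  by rewrite card_prod card_bool cardG; lia.
have TE (x : cocycle_ext cocb) : x \in ext_transversal cocb ->
    #|ext_transversal cocb :&: (x *: ext_transversal cocb)%g| = plus_card b x.2.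
  rewrite inE card_ext_translateI => /negPf ->.
  by apply: eq_card => h; rewrite !inE; case: (b _ _).
exists (ext_transversal cocb), [set x in ext_transversal cocb | x.2 \notin H].
split; first exact: ext_transversalP.
- apply/subsetP => x; rewrite [in X in X -> _]inE => /andP[xT xH].
  rewrite inE xT mem_ext_center andbT; apply: contraNneq xH => ->; exact: group1.
- have -> : (2 * t + 1)%N = #|~: H|.
    by have := cardsC H; rewrite cardG cardH; lia.
  rewrite -(card_imset (~: H) (f := fun h => (false, h) : cocycle_ext cocb)).
    2: by move=> g h [].
  apply: eq_card => -[a g]; rewrite !inE /=; apply/andP/imsetP => [[/negPf -> gH] | [h]].
    by exists g; rewrite // inE.
  by rewrite inE => hH [-> ->].
- by move=> x; rewrite [in X in X -> _]inE => /andP[xT xH]; rewrite TE ?offH.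
- move=> x; rewrite inE inE mem_ext_center negb_or => /andP[/andP[xS x1] xT].
  rewrite TE //; apply: onH x1.
  by apply: contraNT xS => xH; rewrite inE xT.
Qed.

(** * Recovering a cocycle from a transversal *)

Section TransversalCocycle.
Local Open Scope group_scope.
Variables (eT gT : finGroupType) (q : eT -> gT) (z : eT) (T : {set eT}).
Hypotheses (qM : {morph q : x y / x * y}) (q_surj : forall g, exists x, q x = g).
Hypothesis q_fibre : forall x y, q x = q y -> y = x \/ y = x * z.
Hypotheses (qz : q z = 1) (z1 : z != 1) (zz : z * z = 1) (cz : forall x, commute x z).
Hypothesis Tz : forall x, (x * z \in T) = (x \notin T).

Let zpow (c : bool) : eT := if c then z else 1.

Let zpowM c d : zpow c * zpow d = zpow (c (+) d).
Proof. by case: c; case: d; rewrite /= ?mulg1 ?mul1g. Qed.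

Let zpow_inj : injective zpow.
Proof. by case; case=> //= e; move: z1; rewrite -?e ?eqxx // e eqxx. Qed.

Let zpowC c x : zpow c * x = x * zpow c.
Proof. by case: c; rewrite /= ?mulg1 ?mul1g //; apply/esym/cz. Qed.

Lemma exists_section : exists s : gT -> eT,
  [/\ forall g, s g \in T, cancel s q & {in T, cancel q s}].
Proof.
have lift g : exists x, (x \in T) && (q x == g).
  have [x qx] := q_surj g; have [xT | xT] := boolP (x \in T).
    by exists x; rewrite xT qx eqxx.
  by exists (x * z); rewrite Tz xT qM qz mulg1 qx eqxx.
pose s g := xchoose (lift g).
have sP g : (s g \in T) && (q (s g) == g) by exact: (xchooseP (lift g)).
exists s; split=> [g | g | x xT]; try by case/andP: (sP g) => ? /eqP.
have /andP[sT /eqP/q_fibre[<- // | e]] := sP (q x).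
by move: xT; rewrite e Tz sT.
Qed.

(** The section [s] with values in [T] has a factor set [b0], whose row counts are the intersection
    numbers. If [T] contains [z] instead of [1], then [b0 1 1] is true; adding this constant
    normalises the cocycle but complements every row, whence the second alternative. *)
Lemma transversal_cocycle (s : gT -> eT) :
    (forall g, s g \in T) -> cancel s q -> {in T, cancel q s} ->
  exists2 b, sign_cocycle b &
    forall g, plus_card b g = #|T :&: s g *: T|
           \/ (plus_card b g + #|T :&: s g *: T|)%N = #|gT|.
Proof.
move=> sT sK qK; pose b0 g h := s g * s h \notin T.
have sM g h : s g * s h = s (g * h) * zpow (b0 g h).
  have /q_fibre[] : q (s (g * h)) = q (s g * s h) by rewrite qM !sK.
    by rewrite /b0 => ->; rewrite sT mulg1.
  by rewrite /b0 => ->; rewrite Tz sT.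
have b0P g h k : b0 g h (+) b0 (g * h) k = b0 g (h * k) (+) b0 h k.
  (* The cocycle identity is associativity of [s g * s h * s k], with the powers of [z] collected on
     the right. *)
  apply/zpow_inj/(mulgI (s (g * h * k))).
  rewrite -zpowM -[zpow (b0 g h) * _]zpowC mulgA -sM.
  rewrite -mulgA -zpowC mulgA -sM -mulgA sM.
  by rewrite mulgA sM -!mulgA zpowM.
exists (fun g h => b0 g h (+) b0 1 1).
  split; last by rewrite addbb.
  move=> g h k; have := b0P g h k.
  by case: (b0 1 1); case: (b0 g h); case: (b0 (g * h) k); case: (b0 g (h * k));
    case: (b0 h k).
move=> g; have cardT : #|T :&: s g *: T| = #|[set h | ~~ b0 g h]|.
  rewrite card_translateI -(card_imset _ (can_inj sK)); apply: eq_card => x.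
  rewrite !inE; apply/andP/imsetP => [[xT gxT] | [h + ->]].
    by exists (q x); rewrite ?qK // inE /b0 qK // negbK.
  by rewrite inE negbK sT.
rewrite cardT /plus_card; case: (b0 1 1); [right | left]; last first.
  by apply: eq_card => h; rewrite !inE addbF.
rewrite addnC -(cardsC [set h | ~~ b0 g h]); congr (_ + _)%N.
by apply: eq_card => h; rewrite !inE addbT.
Qed.

End TransversalCocycle.

Lemma quasi_Hadamard_excess (eT gT : finGroupType) t (Z : {group eT}) :
    #|gT| = (4 * t + 2)%N -> quasi_Hadamard_group t Z ->
    ([set: eT] / Z \isog [set: gT])%g ->
  exists b : gT -> gT -> bool, sign_cocycle b /\ excess (2 * t + 1) b = (2 * t)%N.
Proof.
move=> cardG [_ cardE cZ [T [S [trT ST cardS onS offS]]]] /isogP[f injf imf].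
have [z [z1 defZ zz cz]] := central_order2P cZ.
have Tz := (transversal_order2P z1 defZ cz T).1 trT.
have nZ x : x \in ('N(Z))%g.
  have /andP[_ /subsetP nZ] : (Z <| [set: eT])%g by apply: sub_center_normal; case: cZ.
  by apply: nZ; rewrite in_setT.
have zZ : z \in Z by rewrite defZ !inE eqxx orbT.
pose q x := f (coset Z x).
have inQ x : coset Z x \in ([set: eT] / Z)%g by rewrite mem_quotient ?in_setT.
have qM : {morph q : x y / (x * y)%g}.
  by move=> x y; rewrite /q (morphM _ (nZ x) (nZ y)) (morphM f (inQ x) (inQ y)).
have q_surj g : exists x, q x = g.
  have : g \in (f @* ([set: eT] / Z))%g by rewrite imf in_setT.
  case/morphimP => _ _ /morphimP[x _ _ ->] ->; exact: ex_intro.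
have q_fibre x y : q x = q y -> y = x \/ y = (x * z)%g.
  move/(injmP injf _ _ (inQ x) (inQ y)) => /esym.
  move/(rcoset_kercosetP (nZ y) (nZ x)); rewrite mem_rcoset defZ !inE.
  rewrite -(inj_eq (mulIg x) _ 1%g) -(inj_eq (mulIg x) _ z) mulgKV mul1g -cz.
  by case/orP=> /eqP ->; [left | right].
have qz : q z = 1%g by rewrite /q coset_id // morph1.
have q1 x : q x = 1%g -> x \in Z.
  move=> qx1.
  have [||] := q_fibre 1%g x; first by rewrite qx1 /q coset_id ?morph1 ?group1.
    by move=> ->; apply: group1.
  by move=> ->; rewrite mul1g.
have [s [sT sK qK]] := exists_section qM q_surj q_fibre qz Tz.
have [b cocb plusb] := transversal_cocycle qM q_fibre z1 zz cz Tz sT sK qK.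
exists b; split=> //.
(* If normalisation complements the row, the count [k] is replaced by [4t + 2 - k], at the same
   distance from [2t + 1]. *)
have term g : g != 1%g ->
    ((plus_card b g - (2 * t + 1)) + (2 * t + 1 - plus_card b g) = (s g \notin S))%N.
  move=> g1; have sZ : s g \notin Z.
    by apply: contra g1 => gZ; rewrite -(sK g) /q coset_id // morph1.
  have := plusb g; rewrite cardG; have [sS | sS] := boolP (s g \in S).
    by rewrite (onS _ sS) /=; lia.
  have : #|T :&: (s g *: T)%g| = (2 * t)%N \/ #|T :&: (s g *: T)%g| = (2 * t + 2)%N.
    by apply: offS; rewrite !inE negb_or sS sZ sT.
  move: #|_ :&: _| => c; rewrite /=; lia.
rewrite /excess (eq_bigr _ term).
have cardST : #|[set g | s g \in S]| = (2 * t + 1)%N.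
  rewrite -cardS -(card_imset _ (can_inj sK)); apply: eq_card => x.
  apply/imsetP/idP => [[g + ->] | xS]; first by rewrite inE.
  have /setDP[xT _] := subsetP ST x xS.
  by exists (q x); rewrite ?inE qK.
have s1 : s 1%g \notin S.
  apply: contraTN (sT 1%g) => s1S; have /setDP[_] := subsetP ST _ s1S.
  by rewrite q1 ?sK.
have : (\sum_g (s g \notin S) = #|~: [set g | s g \in S]|)%N.
  rewrite -sum1_card [RHS]big_mkcond /=; apply: eq_bigr => g _.
  by rewrite !inE; case: (_ \in _).
(* Of the [2t + 1] elements [g] with [s g] outside [S], one is the identity, which [excess] omits;
   [2t] remain. *)
have := cardsC [set g | s g \in S]; rewrite cardST cardG (bigD1 1%g) //= s1.
by move: #|_| (\sum_(_ | _) _)%N => k l /=; lia.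
Qed.

(** * Regular actions by translation and enumeration by cosets *)

Lemma translation_regular_on (aT : finGroupType) (A : {group aT}) (rT : finType)
    (to : {action aT &-> rT}) (F : rT -> aT) (D : {set rT}) (p0 : rT) :
    injective F -> (forall p x, F (to p x) = (F p * x)%g) ->
    (forall p, (p \in D) = (F p \in F p0 *: A)%g) ->
  regular_on A to D.
Proof.
move=> injF toF memD; split.
  (* Under [F] the set [D] is the left coset of [A] through [F p0], which is a single orbit of right
     translation. *)
  apply/imsetP; exists p0; first by rewrite memD lcoset_refl.
  apply/setP=> p; rewrite memD mem_lcoset; apply/idP/orbitP=> [pA | [a aA <-]].
    by exists ((F p0)^-1 * F p)%g => //; apply: injF; rewrite toF mulKVg.
  by rewrite toF mulKg.
move=> p _; apply/trivgP/subsetP => a /setIP[_ /astab1P e].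
by rewrite inE -(inj_eq (mulgI (F p))) -toF e mulg1.
Qed.

(** The outer index [c] selects the right coset of [1] or of some [x] outside [H], so the two cosets
    become the diagonal blocks of a Kronecker product. *)
Lemma index2_enumeration (gT : finGroupType) (H : {group gT}) m :
    #|H| = m -> #|gT| = (2 * m)%N ->
  exists e : 'I_(2 * m) -> gT, bijective e /\
    forall c i c' i', ((e (mxtens_index (c, i)) * (e (mxtens_index (c', i')))^-1)%g \in H)
      = (c == c').
Proof.
move=> cardH cardG.
have [x xH] : exists x, x \notin H.
  have m0 : (0 < m)%N by rewrite -cardH cardG_gt0.
  apply/existsP; apply: contraTT isT; rewrite negb_exists => /forallP allH.
  suff : #|H| = #|gT| by rewrite cardG cardH; lia.
  by rewrite -cardsT; apply: eq_card => y; rewrite inE; apply: negbNE.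
pose hv (i : 'I_m) : gT := enum_val (cast_ord (esym cardH) i).
pose e (k : 'I_(2 * m)) : gT :=
  let: (c, i) := mxtens_unindex k in (hv i * (if c == 0%R :> 'I_2 then 1 else x))%g.
have hvH i : hv i \in H by apply: enum_valP.
have eE c i : e (mxtens_index (c, i)) = (hv i * (if c == 0%R :> 'I_2 then 1 else x))%g.
  by rewrite /e mxtens_indexK.
have ord2 (c : 'I_2) : c = 0%R \/ c = 1%R.
  by case: c => [[|[|//]] p]; [left | right]; apply: val_inj.
have memP c i c' i' :
    ((e (mxtens_index (c, i)) * (e (mxtens_index (c', i')))^-1)%g \in H) = (c == c').
  rewrite !eE invMg !mulgA groupMr ?groupV // -mulgA groupMl //.
  by case: (ord2 c) => ->; case: (ord2 c') => ->;
    rewrite ?eqxx /= ?invg1 ?mulg1 ?mul1g ?mulgV ?groupV ?group1 ?(negPf xH).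
exists e; split=> //; apply: inj_card_bij; last by rewrite card_ord cardG.
move=> k k'; case: (mxtens_indexP k) => c i; case: (mxtens_indexP k') => c' i' ekk'.
have := memP c i c' i'; rewrite ekk' mulgV group1 => /esym/eqP cc'.
move: ekk'; rewrite !eE cc' => /mulIg/enum_val_inj/cast_ord_inj -> //.
Qed.

(** * Agreement of two rows and common blocks *)

Section CommonBlocks.
Variables (gT : finGroupType) (b : gT -> gT -> bool).
Implicit Types (g h k : gT).

(** The inner product of the rows of [g] and [h] in the cocycle matrix is
    [2 * agree g h - #|gT|]. *)
Definition agree g h := #|[set k | ~~ (b g k (+) b h k)]|.

Lemma agree_refl g : agree g g = #|gT|.
Proof. by rewrite -cardsT; apply: eq_card => k; rewrite !inE addbb. Qed.

(** With [q = g * h^-1], the identity at [(q, h, k)] gives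
    [b g k (+) b h k = b q (h * k) (+) b q h]. The constant [b q h] decides between the row count of
    [q] and its complement. *)
Lemma agree_plus_card g h : sign_cocycle b ->
  agree g h = plus_card b (g * h^-1)%g \/
  (agree g h + plus_card b (g * h^-1)%g)%N = #|gT|.
Proof.
move=> [coc _]; set q := (g * h^-1)%g.
have gE : g = (q * h)%g by rewrite mulgKV.
have -> : plus_card b q = #|[set k | ~~ b q (h * k)%g]|.
  rewrite /plus_card -[LHS](card_preimset _ (mulgI h)).
  by apply: eq_card => k; rewrite !inE.
have bgh k : b g k (+) b h k = b q (h * k)%g (+) b q h.
  have := coc q h k; rewrite -gE.
  by case: (b q h); case: (b g k); case: (b q (h * k)%g); case: (b h k).
rewrite /agree; case bqh: (b q h); [right | left].
  rewrite addnC -(cardsC [set k | ~~ b q (h * k)%g]); congr (_ + _)%N.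
  by apply: eq_card => k; rewrite !inE bgh bqh addbT.
by apply: eq_card => k; rewrite !inE bgh bqh addbF.
Qed.

Lemma card_disagree g h : (agree g h + #|[set k | b g k (+) b h k]|)%N = #|gT|.
Proof.
rewrite addnC -(cardsC [set k | b g k (+) b h k]); congr (_ + _)%N.
by apply: eq_card => k; rewrite !inE.
Qed.

(** For [w] over [k], membership of [x * w] in the transversal determines the sign of [w];
    membership of [y * w] then becomes a condition on [k] alone. *)
Lemma card_common_ext (cocb : sign_cocycle b) (x y : cocycle_ext cocb) :
  #|[set w | (x * w \in ext_transversal cocb)%g && (y * w \in ext_transversal cocb)%g]|
    = (if x.1 == y.1 then agree x.2 y.2 else #|gT| - agree x.2 y.2)%N.
Proof.
have -> : (if x.1 == y.1 then agree x.2 y.2 else #|gT| - agree x.2 y.2)%N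
    = #|[set k | b x.2 k (+) b y.2 k == (x.1 (+) y.1)]|.
  rewrite -(card_disagree x.2 y.2) addKn.
  case: eqP => [-> | /eqP ne]; apply: eq_card => k.
    by rewrite !inE addbb; case: (_ (+) _).
  by rewrite !inE; case: x.1 y.1 ne => [] [] //= _; case: (_ (+) _).
rewrite -(card_imset [set k | _] (f := fun k => (x.1 (+) b x.2 k, k) : cocycle_ext cocb)).
  2: by move=> ? ? [].
apply: eq_card => -[a k]; rewrite !inE !ext_mulE /=; apply/andP/imsetP.
  move=> [e1 e2]; exists k.
    rewrite inE; move: e1 e2.
    by case: (x.1); case: (y.1); case: a; case: (b _ _); case: (b _ _).
  by congr pair; move: e1 {e2}; case: (x.1); case: a; case: (b _ _).
case=> k'; rewrite inE => /eqP e [-> ->]; move: e.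
by case: (x.1); case: (y.1); case: (b _ _); case: (b _ _).
Qed.

(** Both alternatives of [agree_plus_card] lead to the same values, because [k] to [4t + 2 - k]
    preserves [2t + 1] and the pair [2t], [2t + 2]. *)
Lemma agree_coset t (H : {group gT}) : sign_cocycle b -> #|gT| = (4 * t + 2)%N ->
    (forall g, g \notin H -> plus_card b g = (2 * t + 1)%N) ->
    (forall g, g \in H -> g != 1%g ->
      plus_card b g = (2 * t)%N \/ plus_card b g = (2 * t + 2)%N) ->
  forall g h, if (g * h^-1)%g \in H
    then g != h -> agree g h = (2 * t)%N \/ agree g h = (2 * t + 2)%N
    else agree g h = (2 * t + 1)%N.
Proof.
move=> cocb cardG offH onH g h; have := agree_plus_card g h cocb; rewrite cardG.
case: ifP => [ghH | /negbT/offH -> ]; last lia.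
move=> e gh; have /(onH _ ghH) : (g * h^-1)%g != 1%g.
  by apply: contraNneq gh => /eqP; rewrite -eq_mulgV1.
by move: e; move: (agree _ _) (plus_card _ _) => k l; lia.
Qed.

End CommonBlocks.

(** * The matrix and the design built from the extension *)

Section Design.
Import GRing.Theory Num.Theory.
Local Open Scope ring_scope.
Variables (gT : finGroupType) (t : nat) (b : gT -> gT -> bool).
Hypotheses (cocb : sign_cocycle b) (cardG : #|gT| = (4 * t + 2)%N).
Variables (H : {group gT}).
Hypothesis offH : forall g, g \notin H -> plus_card b g = (2 * t + 1)%N.
Hypothesis onH : forall g, g \in H -> g != 1%g ->
  plus_card b g = (2 * t)%N \/ plus_card b g = (2 * t + 2)%N.
Variable e : 'I_(2 * (2 * t + 1)) -> gT.
Hypothesis bij_e : bijective e.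
Hypothesis e_coset : forall c i c' i',
  ((e (mxtens_index (c, i)) * (e (mxtens_index (c', i')))^-1)%g \in H) = (c == c').

Local Notation E := (cocycle_ext cocb).
Local Notation T := (ext_transversal cocb).

Definition cocycle_mx : 'M[rat]_(2 * (2 * t + 1)) :=
  \matrix_(i, j) sign_of b (e i) (e j).

(** The outer Kronecker index is the sign, so the points [i] and [i + 4t + 2] are the two elements
    over [e i], as in [point_class]. *)
Definition ext_point (p : 'I_(2 * (2 * (2 * t + 1)))) : E :=
  ((mxtens_unindex p).1 != 0, e (mxtens_unindex p).2).

Definition ext_design : 'M[rat]_(2 * (2 * (2 * t + 1))) :=
  \matrix_(p, B) (ext_point p * ext_point B \in T)%g%:R.

Lemma card_cocycle_ext : #|{: E}| = (8 * t + 4)%N.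
Proof. by rewrite card_prod card_bool cardG; lia. Qed.

Lemma ext_point_inj : injective ext_point.
Proof.
move=> p p'; case: (mxtens_indexP p) => a i; case: (mxtens_indexP p') => a' i'.
rewrite /ext_point !mxtens_indexK /= => -[aa' /(bij_inj bij_e) ->].
congr (mxtens_index (_, _)); apply: val_inj; move: aa'.
by case: a a' => [[|[|//]] ?] [[|[|//]] ?].
Qed.

Lemma ext_point_bij : bijective ext_point.
Proof.
by apply: inj_card_bij ext_point_inj _; rewrite card_ord card_cocycle_ext; lia.
Qed.

Lemma gramE i j :
  (cocycle_mx *m cocycle_mx^T) i j
    = (2 * agree b (e i) (e j))%:R - (4 * t + 2)%:R.
Proof.
rewrite !mxE -cardG -sum_sign [RHS](reindex e) /=; last exact: onW_bij.
by apply: eq_bigr => k _; rewrite !mxE /sign_of signr_addb.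
Qed.

Lemma agree_index c i c' i' :
  let I := mxtens_index (c, i) in let J := mxtens_index (c', i') in
  if c == c'
  then I != J ->
    agree b (e I) (e J) = (2 * t)%N \/ agree b (e I) (e J) = (2 * t + 2)%N
  else agree b (e I) (e J) = (2 * t + 1)%N.
Proof.
move=> I J; have := agree_coset cocb cardG offH onH (e I) (e J).
by rewrite e_coset (inj_eq (bij_inj bij_e)).
Qed.

(** A Gram entry [a] is [4t + 2] on the diagonal, 2 or -2 elsewhere in a diagonal block, and 0
    outside the blocks. Within a block [(a + 2) / 4] and [(2 - a) / 4] detect the values 2 and -2;
    the scalar matrices clear the diagonal. *)
Lemma Delta_cocycle_mxE I J :
  let ag := agree b (e I) (e J) in
  Delta1 cocycle_mx I J = ((I != J) && (ag == 2 * t + 2)%N)%:R /\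
  Delta2 cocycle_mx I J = ((I != J) && (ag == 2 * t)%N)%:R.
Proof.
rewrite /=; case: (mxtens_indexP I) => c k; case: (mxtens_indexP J) => c' k'.
set I' := mxtens_index _; set J' := mxtens_index _; set ag := agree _ _ _.
have -> : Delta1 cocycle_mx I' J' = 4^-1 *
    ((2 * ag)%:R - (4 * t + 2)%:R + 2 * (c == c')%:R - (4 * t + 4)%:R * (I' == J')%:R).
  rewrite /Delta1 -gramE; set A := _ *m _; rewrite [LHS]mxE [X in _ * X]mxE.
  rewrite [X in _ * (X + _)]mxE [X in _ * (_ + X + _)]mxE tensmxE !mxE.
  by rewrite mulr1 !mulr_natr.
have -> : Delta2 cocycle_mx I' J' = 4^-1 *
    (2 * (c == c')%:R + (4 * t)%:R * (I' == J')%:R - ((2 * ag)%:R - (4 * t + 2)%:R)).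
  rewrite /Delta2 -gramE; set A := _ *m _; rewrite [LHS]mxE [X in _ * X]mxE.
  rewrite [X in _ * (X + _)]mxE [X in _ * (X + _ + _)]mxE tensmxE !mxE.
  by rewrite mulr1 !mulr_natr.
have := agree_index c k c' k'; rewrite /= -/I' -/J' -/ag.
have [IJ | IJ] := eqVneq I' J'.
  have [-> _] := can_inj (@mxtens_indexK _ _) IJ.
  rewrite /ag IJ agree_refl cardG eqxx /= => _.
  by rewrite mulr0n mulr1n; split; lra.
have [_ [//| |] -> | _ ->] := eqVneq c c'; rewrite mulr0n ?mulr1n.
all: by split; case: eqP => h; rewrite ?mulr1n ?mulr0n; (lra || lia).
Qed.

Lemma cocycle_mx_admissible : admissible_mx cocycle_mx.
Proof.
split=> [i j | ]; first by rewrite mxE /sign_of; case: (b _ _); [right | left].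
apply/matrixP => I J; rewrite mxE gramE.
case: (mxtens_indexP I) => c i; case: (mxtens_indexP J) => c' i'.
rewrite tensmxE !mxE; have := agree_index c i c' i'; rewrite /=.
case: (eqVneq c c') => [<- | cc'] agr; last first.
  by rewrite agr mul0r; apply/eqP; rewrite normr_eq0 subr_eq0 eqr_nat; lia.
case: (eqVneq i i') agr => [<- _ | ii' ]; last first.
  rewrite (inj_eq (can_inj (@mxtens_indexK _ _))) xpair_eqE eqxx ii' => /(_ isT)[] ->.
    by rewrite ler0_norm ?subr_le0 ?ler_nat ?natrD ?natrM /=; [lra | lia].
  by rewrite ger0_norm ?subr_ge0 ?ler_nat ?natrD ?natrM /=; [lra | lia].
rewrite agree_refl cardG ger0_norm ?subr_ge0 ?ler_nat; last lia.
by rewrite /= ?mulr1n; lra.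
Qed.

Lemma card_ext_design_set (P : pred E) :
  #|[set p | P (ext_point p)]| = #|[set x | P x]|.
Proof.
rewrite -(on_card_preimset (f := ext_point)); last exact: onW_bij ext_point_bij.
by apply: eq_card => p; rewrite !inE.
Qed.

Lemma card_ext_transversal : #|T| = (4 * t + 2)%N.
Proof.
have [z [z1 defZ zz cz]] := central_order2P (ext_center_order2 cocb).
have := card_transversal_order2 z1 defZ zz cz (ext_transversalP cocb).
by rewrite card_cocycle_ext; move: #|_| => k; lia.
Qed.

Lemma ext_design_eq1 p B : (ext_design p B == 1) = (ext_point p * ext_point B \in T)%g.
Proof. by rewrite mxE; case: (_ \in _); rewrite ?eqxx // eq_sym oner_eq0. Qed.

Lemma card_common_blocks p q :
  #|[set B | (ext_design p B == 1) && (ext_design q B == 1)]| =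
    (if (ext_point p).1 == (ext_point q).1 then agree b (ext_point p).2 (ext_point q).2
     else 4 * t + 2 - agree b (ext_point p).2 (ext_point q).2)%N.
Proof.
rewrite -cardG; have /= <- := card_common_ext (ext_point p) (ext_point q).
rewrite -card_ext_design_set.
by apply: eq_card => B; rewrite !inE !ext_design_eq1 !inE.
Qed.

(** Two points share [agree] blocks if their signs are equal and [4t + 2 - agree] otherwise. The
    first relation joins the two elements over one group element, where [agree] is [4t + 2]; the
    second joins different cosets of [H], where it is [2t + 1]. *)
Lemma ext_design_PBIBD : PBIBD4 (4 * t + 2) (4 * t + 2)
  [tuple 0; 2 * t + 1; 2 * t + 2; 2 * t]%N (scheme_rel cocycle_mx) ext_design.
Proof.
split=> [p B | B | p | i p q].
- by rewrite mxE; case: (_ \in _); [right | left].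
- rewrite -card_ext_transversal -(card_preimset _ (mulIg (ext_point B))).
  rewrite -[RHS]cardsE -card_ext_design_set; apply: eq_card => p.
  by rewrite inE ext_design_eq1 !inE.
- rewrite -card_ext_transversal -(card_preimset _ (mulgI (ext_point p))).
  rewrite -[RHS]cardsE -card_ext_design_set; apply: eq_card => B.
  by rewrite inE ext_design_eq1 !inE.
rewrite card_common_blocks /scheme_rel (tnth_nth 0) (tnth_nth 0%N).
case: (mxtens_indexP p) => a I; case: (mxtens_indexP q) => a' J.
have aa' : ((a != 0) == (a' != 0)) = (a == a').
  by case: a a' => [[|[|//]] ?] [[|[|//]] ?].
rewrite /ext_point !mxtens_indexK /= aa'.
set ag := agree b (e I) (e J).
have [D1 D2] := Delta_cocycle_mxE I J; rewrite -/ag in D1 D2.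
have J2I2E u v : (allones 2 - 1%:M : 'M[rat]_2) u v = (u != v)%:R.
  by rewrite !mxE; case: eqVneq => _; rewrite ?subrr ?subr0.
have bool_eq1 (B : bool) : (B%:R == 1 :> rat) = B.
  by case: B; rewrite ?eqxx // eq_sym oner_eq0.
case: i => -[|[|[|[|//]]]] lti /=.
- rewrite tensmxE J2I2E mxE -natrM mulnb bool_eq1 => /andP[/negPf -> /eqP IJ].
  by rewrite /ag IJ agree_refl cardG subnn.
- rewrite tensmxE mxE mul1r /ag.
  case: (mxtens_indexP I) => c k; case: (mxtens_indexP J) => c' k'.
  rewrite tensmxE J2I2E mxE mulr1 bool_eq1 => /negPf cc'.
  by have := agree_index c k c' k'; rewrite /= cc' => ->; case: ifP => _; lia.
(* Equal signs go with [Delta1] and agreement [2t + 2], opposite signs with [Delta2] and agreement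
   [2t]; both yield [2t + 2] common blocks. The last relation exchanges the two. *)
- rewrite mxE !tensmxE J2I2E D1 D2 [_ a a']mxE.
  by case: (eqVneq a a') => _;
    rewrite /= ?mulr1n ?mulr0n ?mul1r ?mul0r ?addr0 ?add0r bool_eq1 => /andP[_ /eqP->];
    lia.
rewrite mxE !tensmxE J2I2E D1 D2 [_ a a']mxE.
by case: (eqVneq a a') => _;
  rewrite /= ?mulr1n ?mulr0n ?mul1r ?mul0r ?addr0 ?add0r bool_eq1 => /andP[_ /eqP->];
  lia.
Qed.

(** A group element [x] sends a point [p] to [p * x] and a block [B] to [x^-1 * B], so the product
    that decides incidence is unchanged. *)
Lemma ext_design_actions :
  exists toP toB : {action E &-> 'I_(2 * (2 * (2 * t + 1)))},
    regular_design_action ext_design toP toB /\ R1_class_regular (ext_center cocb) toP.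
Proof.
have [F' FK F'K] := ext_point_bij.
pose fP p (x : E) := F' (ext_point p * x)%g.
have fP1 p : fP p 1%g = p by rewrite /fP mulg1 FK.
have fPM p x y : fP p (x * y)%g = fP (fP p x) y by rewrite /fP F'K mulgA.
pose fB B (x : E) := F' (x^-1 * ext_point B)%g.
have fB1 B : fB B 1%g = B by rewrite /fB invg1 mul1g FK.
have fBM B x y : fB B (x * y)%g = fB (fB B x) y by rewrite /fB F'K invMg mulgA.
pose toP := TotalAction fP1 fPM; pose toB := TotalAction fB1 fBM.
have toPE p x : ext_point (toP p x) = (ext_point p * x)%g by rewrite /= F'K.
have toBE p x : ext_point (toB p x) = (x^-1 * ext_point p)%g by rewrite /= F'K.
pose p0 := F' 1%g.
exists toP, toB; split; first split.
- by move=> x p B; rewrite !mxE toPE toBE mulgA mulgK.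
- apply: (translation_regular_on (p0 := p0) ext_point_inj toPE) => p.
  by rewrite mem_lcoset !in_setT.
(* Inversion turns the left translation of blocks by [x^-1] into right translation by [x]. *)
- apply: (translation_regular_on (F := fun B => (ext_point B)^-1%g) (p0 := p0)).
  + exact: inj_comp invg_inj ext_point_inj.
  + by move=> B x; rewrite toBE invMg invgK.
  + by move=> B; rewrite mem_lcoset !in_setT.
(* The elements of [ext_center cocb] change only the sign, so the point class of [i] is their coset
   through the point of positive sign over [e i]. *)
move=> i; pose q0 : 'I_(2 * (2 * (2 * t + 1))) := mxtens_index (0, i).
apply: (translation_regular_on (p0 := q0) ext_point_inj toPE) => p.
case: (mxtens_indexP p) => a j; rewrite mem_lcoset mem_ext_center inE.
rewrite /ext_point /q0 !mxtens_indexK /=.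
rewrite -eq_mulVg1 (inj_eq (bij_inj bij_e)) -(inj_eq val_inj) /=.
have := ltn_ord i; have := ltn_ord j; have := ltn_ord a.
by case: a => [[|[|//]] ?] /=; lia.
Qed.

End Design.

(** * Assembly of the equivalences *)

Lemma excess_design (gT : finGroupType) t (b : gT -> gT -> bool) :
    (1 <= t)%N -> #|gT| = (4 * t + 2)%N -> sign_cocycle b ->
    excess (2 * t + 1) b = (2 * t)%N ->
  exists (M : 'M[rat]_(2 * (2 * t + 1))) (Phi : 'M[rat]_(2 * (2 * (2 * t + 1)))),
    [/\ admissible_mx M,
        PBIBD4 (4 * t + 2) (4 * t + 2)
          [tuple 0; 2 * t + 1; 2 * t + 2; 2 * t]%N (scheme_rel M) Phi
      & exists (eT : finGroupType) (Z : {group eT})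
          (toP toB : {action eT &-> 'I_(2 * (2 * (2 * t + 1)))}),
          [/\ quasi_Hadamard_group t Z,
              ([set: eT] / Z \isog [set: gT])%g,
              regular_design_action Phi toP toB
            & R1_class_regular Z toP]].
Proof.
move=> t1 cardG cocb exc; have [H [cardH offH onH]] := excess_min cardG cocb exc.
have [e [bij_e e_coset]] := @index2_enumeration _ H (2 * t + 1) cardH ltac:(lia).
exists (cocycle_mx b e), (ext_design cocb e); split.
- exact: cocycle_mx_admissible e_coset.
- exact: ext_design_PBIBD e_coset.
have [toP [toB [actE regZ]]] := ext_design_actions cocb cardG bij_e.
exists (cocycle_ext cocb), (ext_center cocb), toP, toB; split=> //.
  exact: excess_quasi_Hadamard.
exact: ext_quotient_isog.
Qed.

Theorem theorem7 (t : nat) (gT : finGroupType)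
    (ht : (1 <= t)%N) (hG : #|gT| = (4 * t + 2)%N) :
  let I := exists psi : gT -> gT -> rat,
      cocycle psi /\ quasi_orthogonal t psi in
  let II := exists (eT : finGroupType) (Z : {group eT}),
      [/\ quasi_Hadamard_group t Z,
          ([set: eT] / Z \isog [set: gT])%g
        & exists R : {set eT}, relative_quasi_difference_set t Z R] in
  let III := exists (M : 'M[rat]_(2 * (2 * t + 1)))
        (Phi : 'M[rat]_(2 * (2 * (2 * t + 1)))),
      [/\ admissible_mx M,
          PBIBD4 (4 * t + 2) (4 * t + 2)
            [tuple 0; 2 * t + 1; 2 * t + 2; 2 * t]%N (scheme_rel M) Phi
        & exists (eT : finGroupType) (Z : {group eT})
            (toP toB : {action eT &-> 'I_(2 * (2 * (2 * t + 1)))}),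
            [/\ quasi_Hadamard_group t Z,
                ([set: eT] / Z \isog [set: gT])%g,
                regular_design_action Phi toP toB
              & R1_class_regular Z toP]] in
  (I <-> II) /\ (II <-> III).
Proof.
move=> I II III.
have IP : I <-> exists b, sign_cocycle b /\ @excess gT (2 * t + 1) b = (2 * t)%N.
  exact: quasi_orthogonalP.
(* The way from II to III also passes through I: the design is built on the extension by the
   recovered cocycle. *)
have QH_I (eT : finGroupType) (Z : {group eT}) : quasi_Hadamard_group t Z ->
    ([set: eT] / Z \isog [set: gT])%g -> I.
  by move=> qhE isoE; apply/IP; apply: quasi_Hadamard_excess isoE.
split; split.
- case/IP=> b [cocb exc]; have qhE := excess_quasi_Hadamard cocb ht hG exc.
  exists (cocycle_ext cocb), (ext_center cocb); split=> //.
    exact: ext_quotient_isog.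
  exact: quasi_Hadamard_relative_quasi_difference_set.
- by case=> eT [Z [qhE isoE _]]; apply: QH_I isoE.
- case=> eT [Z [qhE isoE _]]; have /IP[b [cocb exc]] := QH_I _ _ qhE isoE.
  exact: (excess_design ht hG cocb exc).
case=> M [Phi [_ _ [eT [Z [toP [toB [qhE isoE _ _]]]]]]].
exists eT, Z; split=> //.
exact: quasi_Hadamard_relative_quasi_difference_set.
Qed.
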